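(* Let $R$ be any ring with identity, possibly non-commutative. Let $M$ be a $p \times q$ matrix with entries in $R$, and let the columns of $M$ be partitioned into $n$ blocks, $M = [M_1, \ldots, M_n]$ (each $M_i$ consisting of a nonempty set of columns of $M$). Suppose that no $p \times p$ submatrix of $M$ whose columns are taken from pairwise distinct blocks $M_i$ (i.e., at most one column from each block) is invertible. Then there exist an invertible $p \times p$ matrix $Q$ over $R$ and a positive integer $m \leq p$ such that $QM = [QM_1, \ldots, QM_n]$ is in reduced echelon form, and in all but at most $m-1$ of the blocks $QM_i$, every column has the property that its last $m$ entries are either all zero or include at least one non-zero non-unit element of $R$.
   Context: A matrix $N$ over a ring $R$ with $p$ rows is said to be in reduced echelon form if, among all matrices $Q'N$ with $Q'$ an invertible $p \times p$ matrix over $R$, $N$ has the maximum possible number of distinct standard unit vectors (columns with a single entry $1$ and all other entries $0$) appearing as columns. A square matrix is invertible if it has a two-sided inverse over $R$. A unit of $R$ is an element with a two-sided multiplicative inverse; a non-unit is an element that is not a unit. *)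

(* Defs.v *)
From HB Require Import structures.
From mathcomp Require Export all_boot all_order all_algebra.
Set Implicit Arguments.
Unset Strict Implicit.
Unset Printing Implicit Defensive.
Import GRing.Theory.
Local Open Scope ring_scope.

(* Rings are taken in pzRingType: noncommutative rings and the zero ring are
   allowed, and no decision procedure for units is assumed (hence the
   Prop-valued notions below instead of GRing.unit and unitmx). *)

Definition is_unit (R : pzRingType) (x : R) : Prop :=
  exists y : R, x * y = 1 /\ y * x = 1.

Definition invertible_mx (R : pzRingType) (p : nat) (A : 'M[R]_p) : Prop :=
  exists B : 'M[R]_p, A *m B = 1%:M /\ B *m A = 1%:M.

(* The distinct standard unit vectors are counted by their index i < p. *)
Definition num_unit_cols (R : pzRingType) (p q : nat) (N : 'M[R]_(p, q)) : nat :=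
  #|[set i : 'I_p | [exists j : 'I_q, col j N == delta_mx i 0]]|.

Definition reduced_echelon (R : pzRingType) (p q : nat) (N : 'M[R]_(p, q)) : Prop :=
  forall Q' : 'M[R]_p, invertible_mx Q' ->
    (num_unit_cols (Q' *m N) <= num_unit_cols N)%N.

(* A block decomposition [M_1, ..., M_n] is given by the map sending a column
   index to the index of its block; surjectivity says no block is empty. *)
Definition block_partition (q n : nat) (blk : 'I_q -> 'I_n) : Prop :=
  forall k : 'I_n, exists j : 'I_q, blk j = k.

(* f lists, in increasing order, the p columns kept in the submatrix
   colsub f M. *)
Definition from_distinct_blocks (p q n : nat) (blk : 'I_q -> 'I_n)
    (f : 'I_p -> 'I_q) : Prop :=
  (forall i j : 'I_p, (i < j)%N -> (f i < f j)%N) /\ injective (blk \o f).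

Definition last_entries_cond (R : pzRingType) (p : nat) (m : nat)
    (v : 'cV[R]_p) : Prop :=
  (forall i : 'I_p, (p - m <= i)%N -> v i 0 = 0) \/
  (exists i : 'I_p, [/\ (p - m <= i)%N, v i 0 <> 0 & ~ is_unit (v i 0)]).

(* Main.v *)
Require Import Defs.
From mathcomp Require Import all_boot all_order all_algebra.
From mathcomp Require Import perm.
From Stdlib Require Import Classical.
Set Implicit Arguments.
Unset Strict Implicit.
Unset Printing Implicit Defensive.
Import GRing.Theory.
Local Open Scope ring_scope.

(** If some reduced echelon form misses a unit vector, a unit entry in the missing
    row could be pivoted into one more unit vector, so [m = 1] works.  Otherwise
    every unit vector occurs, and one looks for unit columns in pairwise distinct
    blocks as in Hall's theorem: a maximal such family leaves a nonempty set [U] of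
    unmatched rows, and an alternating tree grown from [U] either yields an
    augmenting sequence of pivots or stops at a set [W] of rows such that all
    columns violating the condition on [W] lie in the blocks matched to
    [W :\: U].  Moving [W] to the bottom proves the theorem.  A violating column
    has only zeros and units in [W], so that its first nonzero entry in the order of
    the tree is a legitimate pivot. *)

(** * Maxima, orderings and invertible matrices *)

(** [P] is undecidable in general, so the maximum comes from classical logic, by induction on the
    gap [b - f x]. *)
Lemma ex_maximum (T : Type) (P : T -> Prop) (f : T -> nat) (b : nat) :
  (exists x, P x) -> (forall x, P x -> (f x <= b)%N) ->
  exists2 x, P x & forall y, P y -> (f y <= f x)%N.
Proof.
move=> [x Px] fb.
have [k] := ubnP (b - f x); elim: k x Px => // k IH x Px.
rewrite ltnS => bk.
have [[y Py fy]|nex] := classic (exists2 y, P y & (f x < f y)%N).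
  apply: (IH y Py); apply: leq_trans bk.
  by apply: ltn_sub2l => //; apply: leq_trans fy (fb y Py).
by exists x => // y Py; rewrite leqNgt; apply/negP => fy; apply: nex; exists y.
Qed.

Lemma perm_of_uniq (p : nat) (s : seq 'I_p) :
  uniq s -> size s = p -> exists t : 'S_p, forall i : 'I_p, t i = nth i s i.
Proof.
move=> us sp.
have inj : injective (fun i : 'I_p => nth i s i).
  move=> i j /eqP; rewrite (set_nth_default i j) ?sp //.
  by rewrite nth_uniq ?sp // => /eqP/val_inj.
by exists (perm inj) => i; rewrite permE.
Qed.

Lemma ex_sorting_perm (p q : nat) (c : 'I_p -> 'I_q) : injective c ->
  exists t : 'S_p, forall i j : 'I_p, (i < j)%N -> (c (t i) < c (t j))%N.
Proof.
move=> inj.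
pose le := relpre c (fun x y : 'I_q => (x <= y)%N).
pose s := sort le (enum 'I_p).
have sp : size s = p by rewrite size_sort size_enum_ord.
have us : uniq s by rewrite sort_uniq enum_uniq.
have ss : sorted le s by apply: sort_sorted => x y; apply: leq_total.
have [t tE] := perm_of_uniq us sp.
exists t => i j ij; rewrite ltn_neqAle; apply/andP; split.
  apply/eqP => /val_inj/inj/perm_inj eij; by rewrite eij ltnn in ij.
rewrite !tE (set_nth_default i j) ?sp //.
apply: (sorted_ltn_nth _ i ss) => //; rewrite ?inE ?sp //.
by move=> x y z; apply: leq_trans.
Qed.

Lemma ex_perm_last (p : nat) (W : {set 'I_p}) :
  exists t : 'S_p, forall i : 'I_p, (t i \in W) = (p - #|W| <= i)%N.
Proof.
pose s := enum (~: W) ++ enum W.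
have szC : size (enum (~: W)) = (p - #|W|)%N.
  by rewrite -cardE cardsCs setCK card_ord.
have sp : size s = p.
  rewrite size_cat szC -cardE subnK //.
  by rewrite -[leqRHS](card_ord p) max_card.
have us : uniq s.
  rewrite cat_uniq !enum_uniq andbT; apply/hasPn => i /=.
  by rewrite !mem_enum inE => ->.
have [t tE] := perm_of_uniq us sp.
exists t => i; rewrite tE nth_cat szC; case: ltnP => hi.
  have := mem_nth i (s := enum (~: W)); rewrite szC => /(_ _ hi).
  by rewrite mem_enum inE => /negbTE.
have := mem_nth i (s := enum W) (n := i - (p - #|W|)).
rewrite mem_enum => -> //; rewrite -cardE ltn_subLR //.
by rewrite subnK // -[leqRHS](card_ord p) max_card.
Qed.

Lemma invertible_mx1 (R : pzRingType) (p : nat) : invertible_mx (1%:M : 'M[R]_p).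
Proof. by exists 1%:M; rewrite mulmx1. Qed.

Lemma invertible_mxM (R : pzRingType) (p : nat) (A B : 'M[R]_p) :
  invertible_mx A -> invertible_mx B -> invertible_mx (A *m B).
Proof.
move=> [A' [AA' A'A]] [B' [BB' B'B]]; exists (B' *m A'); split.
  by rewrite mulmxA -(mulmxA A) BB' mulmx1.
by rewrite mulmxA -(mulmxA B') A'A mulmx1.
Qed.

Lemma invertible_perm_mx (R : pzRingType) (p : nat) (t : 'S_p) :
  invertible_mx (perm_mx t : 'M[R]_p).
Proof.
by exists (perm_mx t^-1); rewrite -!perm_mxM mulgV mulVg perm_mx1.
Qed.

(** * Pivoting over a noncommutative ring *)

Lemma col_delta_eq (R : pzRingType) (p q : nat) (N : 'M[R]_(p, q)) (i : 'I_p) (j : 'I_q) :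
  reflect (forall k, N k j = (k == i)%:R) (col j N == delta_mx i 0).
Proof.
apply: (iffP eqP) => [/matrixP e k|e].
  by have := e k 0; rewrite !mxE eqxx andbT.
by apply/matrixP => k l; rewrite !mxE e ord1 eqxx andbT.
Qed.

Lemma mulmx_1Dcol (R : pzRingType) (p q : nat) (v : 'cV[R]_p) (w : 'I_p) (N : 'M[R]_(p, q)) i j :
  ((1%:M + v *m delta_mx 0 w) *m N) i j = N i j + v i 0 * N w j.
Proof.
by rewrite mulmxDl mul1mx -mulmxA -rowE !mxE big_ord1 !mxE.
Qed.

(** Both factors differ from the identity only in column [w]; so does their product, there by
    exactly the sum assumed to vanish. *)
Lemma mulmx_1Dcol_eq1 (R : pzRingType) (p : nat) (a b : 'cV[R]_p) (w : 'I_p) :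
  (forall i, a i 0 + b i 0 + a i 0 * b w 0 = 0) ->
  (1%:M + a *m delta_mx 0 w) *m (1%:M + b *m delta_mx 0 w) = 1%:M.
Proof.
move=> ab0; apply/matrixP => i k.
rewrite mulmx_1Dcol !mxE !big_ord1 !mxE eqxx /=.
have [->|kw] := eqVneq k w; last first.
  by rewrite !mulr0 !addr0 mulr0 addr0.
rewrite !mulr1 mulrDr mulr1 -addrA [X in _ + X]addrA [b i _ + _]addrC ord1.
by rewrite ab0 addr0.
Qed.

Lemma pivot (R : pzRingType) (p q : nat) (N : 'M[R]_(p, q)) (w : 'I_p)
    (j : 'I_q) :
  is_unit (N w j) ->
  exists P : 'M[R]_p,
    [/\ invertible_mx P,
        forall i, (P *m N) i j = (i == w)%:R,
        forall i k, N w k = 0 -> (P *m N) i k = N i k &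
        forall i k, i != w -> N i j = 0 -> (P *m N) i k = N i k].
Proof.
move=> [y [uy yu]].
(* Solves [N i j + v i 0 * N w j = (i == w)%:R]; row operations multiply on the left, so [y] stands
   on the right. *)
pose v := \col_i (((i == w)%:R - N i j) * y) : 'cV[R]_p.
exists (1%:M + v *m delta_mx 0 w); split.
(* The inverse is the identity with column [w] replaced by column [j] of [N]. *)
- exists (1%:M + (\col_i (N i j - (i == w)%:R)) *m delta_mx 0 w).
  split; apply: mulmx_1Dcol_eq1 => i; rewrite !mxE eqxx -[N i j - _]opprB.
    by rewrite mulrBr mulr1 -mulrA yu mulr1 addrA subrK subrr.
  rewrite [(true%:R - _) * y]mulrBl mul1r uy mulNr mulrBr mulr1 [- (_ * y - _)]opprB.
  by rewrite [- _ + _]addrC addrA subrK subrr.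
- by move=> i; rewrite mulmx_1Dcol !mxE -mulrA yu mulr1 addrC subrK.
- by move=> i k Nk; rewrite mulmx_1Dcol Nk mulr0 addr0.
- by move=> i k iw Nk; rewrite mulmx_1Dcol !mxE Nk (negbTE iw) subr0 !mul0r addr0.
Qed.

(** * Alternating trees and augmentation *)

(** Classically the negation of [last_entries_cond], with the rows of [W] in place of the last
    [m]. *)
Definition bad_col (R : pzRingType) (p q : nat) (N : 'M[R]_(p, q))
    (W : {set 'I_p}) (j : 'I_q) : Prop :=
  (forall i, i \in W -> N i j = 0 \/ is_unit (N i j)) /\
  (exists2 i, i \in W & N i j <> 0).

Lemma bad_col_ext (R : pzRingType) (p q : nat) (N N' : 'M[R]_(p, q))
    (W : {set 'I_p}) (j : 'I_q) :
  (forall i, i \in W -> N' i j = N i j) -> bad_col N W j -> bad_col N' W j.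
Proof.
move=> e [h [i iW nz]]; split; last by exists i; rewrite ?e.
by move=> k kW; rewrite e //; apply: h.
Qed.

(* Alternating-tree search: [c i] is the column carrying the [i]-th unit vector,
   and [U] is the set of rows not yet matched to pairwise distinct blocks. *)
Inductive reach (R : pzRingType) (p q n : nat) (blk : 'I_q -> 'I_n)
    (N : 'M[R]_(p, q)) (c : 'I_p -> 'I_q) (U : {set 'I_p}) :
    {set 'I_p} -> Prop :=
| reach0 : reach blk N c U U
| reachS (W : {set 'I_p}) (i : 'I_p) (j : 'I_q) :
    reach blk N c U W -> i \notin W -> blk j = blk (c i) -> bad_col N W j ->
    reach blk N c U (i |: W).

Lemma reach_sub (R : pzRingType) (p q n : nat) (blk : 'I_q -> 'I_n)
    (N : 'M[R]_(p, q)) (c : 'I_p -> 'I_q) (U W : {set 'I_p}) :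
  reach blk N c U W -> U \subset W.
Proof.
elim=> [|V i j _ UV _ _ _] //; exact: subset_trans UV (subsetUr _ _).
Qed.

(** Rows in [U] also keep a unit column, but its block may be shared. *)
Definition matching (R : pzRingType) (p q n : nat) (blk : 'I_q -> 'I_n)
    (N : 'M[R]_(p, q)) (c : 'I_p -> 'I_q) (U : {set 'I_p}) : Prop :=
  (forall i k, N k (c i) = (k == i)%:R) /\
  {in ~: U &, injective (blk \o c)}.

Definition upd (p q : nat) (c : 'I_p -> 'I_q) (w : 'I_p) (j : 'I_q) :
    'I_p -> 'I_q := fun i => if i == w then j else c i.

(** The other columns [c i] vanish in row [w], so the pivot preserves them. Using [U :\ w] covers
    both matching a new row and rematching an old one. *)
Lemma matching_pivot (R : pzRingType) (p q n : nat) (blk : 'I_q -> 'I_n)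
    (N N' : 'M[R]_(p, q)) (c : 'I_p -> 'I_q) (U : {set 'I_p}) w j :
  matching blk N c U -> (forall i, i \in ~: U -> blk j <> blk (c i)) ->
  (forall i, N' i j = (i == w)%:R) ->
  (forall i k, N w k = 0 -> N' i k = N i k) ->
  matching blk N' (upd c w j) (U :\ w).
Proof.
move=> [cN inj] jU N'j N'0; split.
  move=> i k; rewrite /upd; have [->//|iw] := eqVneq i w.
  by rewrite N'0 ?cN // eq_sym (negbTE iw).
move=> a b; rewrite /upd /= !inE !negb_and !negbK.
have [->|aw] := eqVneq a w; have [->|bw] := eqVneq b w => //= aU bU e.
- by case: (jU b); rewrite ?inE.
- by case: (jU a); rewrite ?inE.
- by apply: inj; rewrite ?inE.
Qed.

(* Pivoting at the first row, in the order of the tree, where the column is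
   nonzero leaves the earlier rows unchanged, so the earlier tree survives. *)
Lemma augment (R : pzRingType) (p q n : nat) (blk : 'I_q -> 'I_n)
    (N : 'M[R]_(p, q)) (c : 'I_p -> 'I_q) (U W : {set 'I_p}) (j : 'I_q) :
  reach blk N c U W -> matching blk N c U ->
  (forall i, i \in ~: U -> blk j <> blk (c i)) -> bad_col N W j ->
  exists (P : 'M[R]_p) (c' : 'I_p -> 'I_q) (U' : {set 'I_p}),
    [/\ invertible_mx P, matching blk (P *m N) c' U' & (#|U'| < #|U|)%N].
Proof.
move=> rW.
(* Pivots alter rows outside the smaller tree, so the induction only asks for agreement with [N] and
   [c] on [W]. *)
suff gen (N' : 'M[R]_(p, q)) c' : (forall i k, i \in W -> N' i k = N i k) ->
    {in W, c' =1 c} -> matching blk N' c' U ->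
    (forall i, i \in ~: U -> blk j <> blk (c' i)) -> bad_col N' W j ->
    exists (P : 'M[R]_p) (c' : 'I_p -> 'I_q) (U' : {set 'I_p}),
      [/\ invertible_mx P, matching blk (P *m N') c' U' & (#|U'| < #|U|)%N].
  by apply: gen.
elim: rW j N' c' => [|V i j0 rV IH iV blkj0 bad0] j N' c' eN ec mt jU.
  move=> [h [w wU nz]]; have [//|u] := h w wU.
  have [P [iP Pj P0 _]] := pivot u.
  exists P, (upd c' w j), (U :\ w); split=> //.
    exact: matching_pivot mt jU Pj P0.
  by rewrite [ltnRHS](cardsD1 w) wU.
move=> [h [w wV nz]].
have eNV a k : a \in V -> N' a k = N a k by move=> aV; apply: eN; rewrite !inE aV orbT.
have ecV : {in V, c' =1 c} by move=> a aV; apply: ec; rewrite !inE aV orbT.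
(* A column nonzero on [V] is handled by the smaller tree; otherwise its only nonzero entry on the
   tree is the unit in row [i]. *)
have [[a aV naz]|zV] := classic (exists2 a, a \in V & N' a j <> 0).
  apply: (IH j N' c') => //; split; last by exists a.
  by move=> b bV; apply: h; rewrite !inE bV orbT.
have zV' a : a \in V -> N' a j = 0.
  by move=> aV; apply: NNPP => naz; apply: zV; exists a.
have wi : w = i.
  by move: wV; rewrite !inE => /orP[/eqP//|/zV'].
rewrite {}wi {wV} in nz.
have [//|u] := h i (setU11 _ _).
have [P [iP Pj P0 Pz]] := pivot u.
have iU : i \in ~: U by rewrite inE; apply: contra iV; apply/subsetP/reach_sub/rV.
have ePV a k : a \in V -> (P *m N') a k = N a k.
  move=> aV; rewrite -(eNV a k aV); apply: Pz; last exact: zV'.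
  by apply: contraNneq iV => <-.
have UiU : U :\ i = U.
  by apply/setDidPl; rewrite disjoint_sym disjoints1 -in_setC.
have mt' : matching blk (P *m N') (upd c' i j) U.
  by rewrite -[U in matching _ _ _ U]UiU; apply: matching_pivot mt jU Pj P0.
have ec' : {in V, upd c' i j =1 c}.
  move=> a aV; rewrite /upd; have [ai|_] := eqVneq a i; last exact: ecV.
  by rewrite -ai aV in iV.
(* Moving row [i] to column [j] frees its former block, which is the block of [j0]. *)
have j0U a : a \in ~: U -> blk j0 <> blk (upd c' i j a).
  move=> aU; rewrite blkj0 -ec ?setU11 // /upd.
  have [_ e|ai e] := eqVneq a i; first exact: (jU i).
  by case/eqP: ai; apply: mt.2.
have bad0' : bad_col (P *m N') V j0.
  by apply: bad_col_ext bad0 => a aV; apply: ePV.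
have [P' [c'' [U' [iP' m' lt]]]] := IH _ _ _ ePV ec' mt' j0U bad0'.
exists (P' *m P), c'', U'; split=> //.
  exact: invertible_mxM.
by rewrite -mulmxA.
Qed.

(** * Row permutations and unit columns *)

Lemma num_unit_cols_row_perm (R : pzRingType) (p q : nat) (N : 'M[R]_(p, q))
    (t : 'S_p) : num_unit_cols (row_perm t N) = num_unit_cols N.
Proof.
rewrite /num_unit_cols -(card_imset _ (@perm_inj _ t)).
congr #|pred_of_set _|; apply/setP => i; apply/imsetP/idP.
  move=> [k]; rewrite !inE => /existsP[j /col_delta_eq e] ->.
  apply/existsP; exists j; apply/col_delta_eq => l.
  by have := e (t^-1 l)%g; rewrite mxE permKV => ->; rewrite (can2_eq (permKV t) (permK t)).
rewrite inE => /existsP[j /col_delta_eq e].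
exists (t^-1 i)%g; last by rewrite permKV.
rewrite inE; apply/existsP; exists j; apply/col_delta_eq => l.
by rewrite mxE e (can2_eq (permK t) (permKV t)).
Qed.

Lemma reduced_echelon_row_perm (R : pzRingType) (p q : nat) (N : 'M[R]_(p, q))
    (t : 'S_p) : reduced_echelon N -> reduced_echelon (row_perm t N).
Proof.
move=> rN Q' iQ; rewrite num_unit_cols_row_perm row_permE mulmxA.
by apply: rN; apply: invertible_mxM iQ (invertible_perm_mx _ _).
Qed.

Lemma not_bad_col_last (R : pzRingType) (p q : nat) (N : 'M[R]_(p, q))
    (t : 'S_p) (W : {set 'I_p}) (j : 'I_q) :
  (forall i : 'I_p, (t i \in W) = (p - #|W| <= i)%N) -> ~ bad_col N W j ->
  last_entries_cond #|W| (col j (row_perm t N)).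
Proof.
move=> tW nb.
have [[i iW [nz nu]]|none] :=
  classic (exists2 i, i \in W & N i j <> 0 /\ ~ is_unit (N i j)).
  by right; exists (t^-1 i)%g; rewrite -tW !mxE permKV.
left=> i; rewrite -tW !mxE => tiW; apply: NNPP => nz; apply: nb; split.
  move=> k kW; have [->|nzk] := classic (N k j = 0); first by left.
  by right; apply: NNPP => nu; apply: none; exists k.
by exists (t i).
Qed.

Lemma matching_num_unit_cols (R : pzRingType) (p q : nat) (N : 'M[R]_(p, q))
    (c : 'I_p -> 'I_q) :
  (forall i k, N k (c i) = (k == i)%:R) -> num_unit_cols N = p.
Proof.
move=> cN; rewrite /num_unit_cols -[RHS]card_ord -cardsT.
congr #|pred_of_set _|; apply/setP => i; rewrite !inE.
by apply/existsP; exists (c i); apply/col_delta_eq.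
Qed.

Lemma num_unit_cols_le (R : pzRingType) (p q : nat) (N : 'M[R]_(p, q)) :
  (num_unit_cols N <= p)%N.
Proof. by rewrite -[leqRHS](card_ord p) max_card. Qed.

(** Sorting the matched columns turns them into a permutation matrix in [Q *m M]; multiplying by the
    inverse of [Q] gives the submatrix of [M]. *)
Lemma perfect_matching_invertible (R : pzRingType) (p q n : nat)
    (blk : 'I_q -> 'I_n) (M : 'M[R]_(p, q)) (Q : 'M[R]_p) (c : 'I_p -> 'I_q) :
  invertible_mx Q -> matching blk (Q *m M) c set0 ->
  exists2 f, from_distinct_blocks blk f & invertible_mx (colsub f M).
Proof.
move=> [Q' [QQ' Q'Q]] [cN inj].
have inj' : injective (blk \o c) by move=> a b; apply: inj; rewrite !inE.
have [t tlt] := ex_sorting_perm (inj_compr inj').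
exists (c \o t); first by split=> // a b /inj'/perm_inj.
have -> : colsub (c \o t) M = Q' *m perm_mx t^-1.
  have <- : colsub (c \o t) (Q *m M) = perm_mx t^-1.
    apply/matrixP => i k; rewrite mxE cN !mxE.
    by rewrite (can2_eq (permKV t) (permK t)).
  have -> : colsub (c \o t) (Q *m M) = Q *m colsub (c \o t) M.
    by apply/matrixP => i k; rewrite !mxE; apply: eq_bigr => l _; rewrite !mxE.
  by rewrite mulmxA Q'Q mul1mx.
by apply: invertible_mxM (invertible_perm_mx _ _); exists Q.
Qed.

(** * Choice of the rows and conclusion *)

Lemma ex_good_rows (R : pzRingType) (p q n : nat) (M : 'M[R]_(p, q))
    (blk : 'I_q -> 'I_n) :
  (forall f : 'I_p -> 'I_q, from_distinct_blocks blk f ->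
     ~ invertible_mx (colsub f M)) ->
  exists (Q : 'M[R]_p) (W : {set 'I_p}) (E : {set 'I_n}),
    [/\ invertible_mx Q, reduced_echelon (Q *m M), (#|E| < #|W|)%N
      & forall j, blk j \notin E -> ~ bad_col (Q *m M) W j].
Proof.
move=> hM.
have [] := @ex_maximum _ (@invertible_mx R p) (fun Q => num_unit_cols (Q *m M)) p.
- by exists 1%:M; apply: invertible_mx1.
- by move=> Q _; apply: num_unit_cols_le.
move=> Q iQ Qmax.
pose I := [set i : 'I_p | [exists j : 'I_q, col j (Q *m M) == delta_mx i 0]].
have [[w wI]|full] := classic (exists w, w \notin I).
  exists Q, [set w], set0; split=> //.
  - by move=> Q' iQ'; rewrite mulmxA; apply: Qmax; apply: invertible_mxM.
  - by rewrite cards0 cards1.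
  move=> j _ [h [_ /set1P-> nz]].
  have [//|u] := h w (set11 w).
  have [P [iP Pj P0 _]] := pivot u.
  have := Qmax _ (invertible_mxM iP iQ); rewrite -mulmxA leqNgt => /negP; apply.
  (* Unit columns of index other than [w] survive the pivot, which adds index [w]. *)
  apply: (@leq_trans #|w |: I|); first by rewrite cardsU1 wI.
  apply/subset_leq_card/subsetP => i; rewrite in_setU1 inE.
  case/orP=> [/eqP->|iI]; first by apply/existsP; exists j; apply/col_delta_eq.
  have iw : i != w by apply: contraNneq wI => <-.
  move: iI; rewrite inE => /existsP[k /col_delta_eq e].
  apply/existsP; exists k; apply/col_delta_eq => l.
  by rewrite P0 ?e // eq_sym (negbTE iw).
have full' i : exists j, col j (Q *m M) == delta_mx i 0.
  have : i \in I by apply: contraT => iI; case: full; exists i.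
  by rewrite inE => /existsP.
pose c0 i := xchoose (full' i).
pose st (x : 'M[R]_p * ('I_p -> 'I_q) * {set 'I_p}) :=
  invertible_mx x.1.1 /\ matching blk (x.1.1 *m M) x.1.2 x.2.
have [] := @ex_maximum _ st (fun x => #|~: x.2|) p.
(* With every row unmatched, distinctness of blocks is vacuous. *)
- exists (Q, c0, [set: 'I_p]); split=> //; split=> /=.
    by move=> i; apply/col_delta_eq/(xchooseP (full' i)).
  by move=> a b; rewrite !inE.
- by move=> x _; rewrite -[leqRHS](card_ord p) max_card.
move=> {Q iQ Qmax I full full' c0} [[Q c] U] [/= iQ mt] Umin.
have {}Umin Q' c' U' : invertible_mx Q' -> matching blk (Q' *m M) c' U' ->
    (#|U| <= #|U'|)%N.
  move=> iQ' m'; have := Umin (Q', c', U') (conj iQ' m') => /=.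
  rewrite -(leq_add2l #|U'|) -(leq_add2l #|U|) addnA [X in (_ <= X)%N]addnCA.
  by rewrite !cardsC -addnA cardsC leq_add2r.
have [] := @ex_maximum _ (reach blk (Q *m M) c U) (fun W => #|W|) p.
- by exists U; apply: reach0.
- by move=> x _; rewrite -[leqRHS](card_ord p) max_card.
move=> W rW Wmax.
have U0 : U != set0.
  apply/eqP => U0; rewrite U0 in mt.
  by have [f /hM] := perfect_matching_invertible iQ mt.
have UW := reach_sub rW.
(* Since [U] is nonempty, [W :\: U] has fewer rows than [W], hence so few blocks. Having all [p]
   unit columns makes any such [Q *m M] reduced. *)
exists Q, W, ((blk \o c) @: (W :\: U)); split=> //.
- by move=> Q' iQ'; rewrite (matching_num_unit_cols mt.1) num_unit_cols_le.
- apply: leq_ltn_trans (leq_imset_card _ _) _.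
  rewrite cardsD (setIidPr UW) ltn_subrL card_gt0 U0 /=.
  by apply: leq_trans (subset_leq_card UW); rewrite card_gt0.
move=> j jE badj.
(* A bad column in the block of a matched row, necessarily outside [W], would enlarge the maximal
   tree; in an unmatched block it would augment the matching. *)
have [[i iU ji]|jU] := classic (exists2 i, i \in ~: U & blk j = blk (c i)).
  have iW : i \notin W.
    apply: contra jE => iW; apply/imsetP; exists i => //.
    by rewrite !inE iW andbT; rewrite inE in iU.
  have := Wmax _ (reachS rW iW ji badj).
  by rewrite cardsU1 iW ltnn.
have [|P [c' [U' [iP m' lt]]]] := augment rW mt _ badj.
  by move=> i iU ji; apply: jU; exists i.
have := Umin _ c' U' (invertible_mxM iP iQ); rewrite -mulmxA => /(_ m').
by rewrite leqNgt lt.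
Qed.

Theorem mainTheorem1 (R : pzRingType) (p q n : nat) (M : 'M[R]_(p, q))
    (blk : 'I_q -> 'I_n) (hblk : block_partition blk)
    (hM : forall f : 'I_p -> 'I_q, from_distinct_blocks blk f ->
            ~ invertible_mx (colsub f M)) :
  exists (Q : 'M[R]_p) (m : nat),
    [/\ invertible_mx Q,
        (0 < m <= p)%N,
        reduced_echelon (Q *m M)
      & exists E : {set 'I_n},
          (#|E| <= m - 1)%N /\
          (forall k : 'I_n, k \notin E ->
             forall j : 'I_q, blk j = k -> last_entries_cond m (col j (Q *m M)))].
Proof.
have [Q [W [E [iQ rQ EW good]]]] := ex_good_rows hM.
have [t tW] := ex_perm_last W.
have W0 : (0 < #|W|)%N by apply: leq_ltn_trans EW.
have eQ : perm_mx t *m Q *m M = row_perm t (Q *m M).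
  by rewrite row_permE mulmxA.
exists (perm_mx t *m Q), #|W|; rewrite eQ; split.
- exact: invertible_mxM (invertible_perm_mx _ _) iQ.
- by rewrite W0 -[leqRHS](card_ord p) max_card.
- exact: reduced_echelon_row_perm.
exists E; split; first by rewrite subn1 -ltnS prednK.
by move=> _ /[swap] j /[swap] <- /good; apply: not_bad_col_last.
Qed.
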